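(* Let $K_q^d$ be the $d$-dimensional Hamming graph on the alphabet $[q]$ and let $K_2^d$ be the $d$-dimensional hypercube. Then for $d\geq 2$, $$\log q \;\leq\; \mathrm{boxicity}(K_q^d) \;\leq\; \lceil 10\log q\rceil\, \mathrm{boxicity}(K_2^d)$$ and $$\log q \;\leq\; \mathrm{cubicity}(K_q^d) \;\leq\; \lceil 10\log q\rceil\, \mathrm{cubicity}(K_2^d).$$
   Context: All graphs are finite, undirected and simple. $[q]=\{1,\ldots,q\}$, and all logarithms are to base $2$. A $k$-box is a Cartesian product of $k$ closed intervals of $\mathbb{R}$, and a $k$-cube is a Cartesian product of $k$ closed intervals of unit length. A $k$-box ($k$-cube) representation of a graph $G$ is a function $f$ mapping each vertex to a $k$-box ($k$-cube) such that for any two distinct vertices $u,v$, $uv\in E(G)$ if and only if $f(u)\cap f(v)\neq\emptyset$. The boxicity (cubicity) of $G$ is the smallest natural number $k$ (with $0$ allowed; complete graphs have boxicity and cubicity $0$) such that $G$ has a $k$-box ($k$-cube) representation. The Hamming graph $K_q^d$ is the Cartesian product of $d$ copies of the complete graph $K_q$, i.e. the graph on $[q]^d$ with two vertices adjacent iff they differ in exactly one coordinate. The $d$-dimensional hypercube is $K_2^d$. *)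

(* Defs.v *)
From HB Require Import structures.
From mathcomp Require Import all_boot all_order all_algebra.
From mathcomp Require Import boolp classical_sets reals exp.

Set Implicit Arguments.
Unset Strict Implicit.
Unset Printing Implicit Defensive.

Import Order.TTheory GRing.Theory Num.Theory.
Local Open Scope classical_set_scope.
Local Open Scope ring_scope.

Record sgraph := SGraph {
  vertex :> finType;
  adj : rel vertex;
  adj_sym : symmetric adj;
  adj_irrefl : irreflexive adj }.

Section Hamming.
Variables q d : nat.
Implicit Types x y : {ffun 'I_d -> 'I_q}.

(* The alphabet [q] is encoded as {0, ..., q-1}. *)
Definition hamming_adj x y := #|[pred i | x i != y i]| == 1%N.

Fact hamming_adj_sym : symmetric hamming_adj.
Proof.
move=> x y; rewrite /hamming_adj; congr (_ == _); apply: eq_card => i.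
by rewrite !inE eq_sym.
Qed.

Fact hamming_adj_irrefl : irreflexive hamming_adj.
Proof.
by move=> x; rewrite /hamming_adj eq_card0 // => i; rewrite !inE eqxx.
Qed.

Definition hamming := SGraph hamming_adj_sym hamming_adj_irrefl.
End Hamming.

Section Boxicity.
Variable R : realType.
Implicit Types (k : nat) (G : sgraph).

Definition interval_prod k (a b : 'rV[R]_k) : set 'rV[R]_k :=
  [set x | forall i, a ord0 i <= x ord0 i <= b ord0 i].

(* Intervals are nonempty, possibly reduced to a point. For k = 0 the only box
   (and the only cube) is the one-point space 'rV[R]_0. *)
Definition is_box k (B : set 'rV[R]_k) : Prop :=
  exists a b : 'rV[R]_k,
    (forall i, a ord0 i <= b ord0 i) /\ B = interval_prod a b.

Definition is_cube k (B : set 'rV[R]_k) : Prop :=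
  exists a b : 'rV[R]_k,
    (forall i, b ord0 i - a ord0 i = 1) /\ B = interval_prod a b.

Definition intersection_repr k G (f : G -> set 'rV[R]_k) : Prop :=
  forall u v : G, u != v -> (adj u v <-> f u `&` f v !=set0).

Definition has_box_repr G k : Prop :=
  exists f : G -> set 'rV[R]_k, (forall v, is_box (f v)) /\ intersection_repr f.

Definition has_cube_repr G k : Prop :=
  exists f : G -> set 'rV[R]_k, (forall v, is_cube (f v)) /\ intersection_repr f.

Lemma cube_box k (B : set 'rV[R]_k) : is_cube B -> is_box B.
Proof.
move=> [a [b [ab ->]]]; exists a, b; split=> // i.
by rewrite -subr_ge0 ab ler01.
Qed.

Lemma cube_box_repr G k : has_cube_repr G k -> has_box_repr G k.
Proof. by move=> [f [fc fi]]; exists f; split=> // v; apply: cube_box. Qed.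

Lemma has_cube_repr_card G : has_cube_repr G #|G|.
Proof.
pose c (v w : G) : R := if v == w then 0 else if adj v w then 1 else 2.
pose a v : 'rV[R]_#|G| := \row_i c v (enum_val i).
pose b v : 'rV[R]_#|G| := \row_i (c v (enum_val i) + 1).
exists (fun v => interval_prod (a v) (b v)); split=> [v|u v uv].
  by exists (a v), (b v); split=> // i; rewrite !mxE addrC addKr.
have c0 w w' : 0 <= c w w' by rewrite /c; do 2?case: ifP.
have c2 w w' : c w w' <= 2.
  by rewrite /c; case: ifP => // _; case: ifP => // _; rewrite ler1n.
have c1 w w' : w != w' -> 1 <= c w w'.
  by rewrite /c => /negbTE ->; case: ifP => // _; rewrite ler1n.
have half s t w : s != t -> adj s t -> c s w <= c t w + 1.
  move=> st est; have [tw|tw] := eqVneq t w.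
    by rewrite -tw /c (negbTE st) est eqxx add0r.
  by apply: le_trans (c2 _ _) _; rewrite -[2]/(1 + 1) lerD2r c1.
split=> [euv|[x [/= xu xv]]].
  exists (\row_i Num.max (c u (enum_val i)) (c v (enum_val i))).
  split=> i; rewrite !mxE le_max ge_max lexx ?orbT //= lerDl ler01 ?andbT /=.
    by apply: half; rewrite 1?eq_sym // adj_sym.
  by apply: half.
apply/negP => /negP nuv.
have := xu (enum_rank u); have := xv (enum_rank u).
rewrite !mxE enum_rankK /c eqxx (eq_sym v) (negbTE uv) adj_sym (negbTE nuv).
move=> /andP[x2 _] /andP[_ x1]; have := le_trans x2 x1.
by rewrite add0r -[1]/(1%:R) ler_nat.
Qed.

Fact box_repr_ex G : exists k, `[< has_box_repr G k >].
Proof. by exists #|G|; apply/asboolP/cube_box_repr/has_cube_repr_card. Qed.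

Fact cube_repr_ex G : exists k, `[< has_cube_repr G k >].
Proof. by exists #|G|; apply/asboolP/has_cube_repr_card. Qed.

Definition boxicity G : nat := ex_minn (box_repr_ex G).
Definition cubicity G : nat := ex_minn (cube_repr_ex G).

Definition log2 (x : R) : R := ln x / ln 2.
End Boxicity.

(* Main.v *)
(* Lower bound: in each coordinate of a box representation of the rook's graph
   K_q^2, the intervals of row i share a point r_i and those of column j share
   a point c_j (Helly).  If i <> j and the comparisons r_i < c_i and r_j < c_j
   have the same outcome in every coordinate, then the boxes of the
   non-adjacent vertices (i, j) and (j, i) intersect.  Hence the q vectors of
   outcomes in {true, false}^k are distinct and q <= 2^k.

   Upper bound: a map h : [q] -> [2] applied letter by letter sends adjacent
   words to equal or adjacent ones.  If m such maps are chosen so that any two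
   pairs of distinct letters are split simultaneously by one of them, then
   pulling back a representation of K_2^d along each of them and concatenating
   gives one of K_q^d.  A uniformly random map splits two given pairs with
   probability at least 1/4, so the union bound provides such a family as soon
   as q^4 (3/4)^m < 1, and m = ceil (10 log q) suffices because 3^5 < 4^4. *)
Require Import Defs.
From HB Require Import structures.
From mathcomp Require Import all_boot all_order all_algebra.
From mathcomp Require Import boolp classical_sets reals exp.

Set Implicit Arguments.
Unset Strict Implicit.
Unset Printing Implicit Defensive.

Import Order.TTheory GRing.Theory Num.Theory.
Local Open Scope ring_scope.

(** * Representations in terms of interval endpoints *)

Section EndpointRepresentations.
Variable R : realType.
Implicit Types (P : R -> R -> Prop) (G H : sgraph) (k m : nat).

(* [P] constrains the two endpoints of every interval: [a <= b] for boxes,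
   [b - a = 1] for cubes. *)
Definition endpoint_repr P G k : Prop :=
  exists a b : G -> 'rV[R]_k,
    (forall v i, P (a v ord0 i) (b v ord0 i)) /\
    (forall u v, u != v ->
      (adj u v <-> forall i, a u ord0 i <= b v ord0 i /\
                             a v ord0 i <= b u ord0 i)).

Lemma interval_prod_meet k (a b c d : 'rV[R]_k) :
    (forall i, a ord0 i <= b ord0 i) -> (forall i, c ord0 i <= d ord0 i) ->
  (interval_prod a b `&` interval_prod c d !=set0)%classic <->
  (forall i, a ord0 i <= d ord0 i /\ c ord0 i <= b ord0 i).
Proof.
move=> ab cd; split=> [[x [/= xab xcd]] i|meet].
  have /andP[ax xb] := xab i; have /andP[cx xd] := xcd i.
  by split; [apply: le_trans ax xd | apply: le_trans cx xb].
exists (\row_i Num.max (a ord0 i) (c ord0 i)).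
split=> i; rewrite !mxE le_max ge_max lexx ?orbT /=.
  by rewrite ab (proj2 (meet i)).
by rewrite cd (proj1 (meet i)).
Qed.

(** Since [P] forces nonempty intervals, intersection reduces to inequalities between endpoints;
    boxes and cubes are two choices of [P]. *)
Lemma intersection_repr_endpoints P G k : (forall x y, P x y -> x <= y) ->
  (exists f : G -> set 'rV[R]_k,
     (forall v, exists a b : 'rV[R]_k,
        (forall i, P (a ord0 i) (b ord0 i)) /\ f v = interval_prod a b) /\
     intersection_repr f) <->
  endpoint_repr P G k.
Proof.
move=> Ple; split=> [[f [/choice[a /choice[b fE]] fr]]|[a [b [Pab abr]]]].
  exists a, b; split=> [v|u v uv]; first exact: (proj1 (fE v)).
  rewrite (fr u v uv) (proj2 (fE u)) (proj2 (fE v)).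
  by apply: interval_prod_meet => i; apply/Ple/(proj1 (fE _)).
exists (fun v => interval_prod (a v) (b v)); split=> [v|u v uv].
  by exists (a v), (b v).
rewrite (abr u v uv); apply: iff_sym.
by apply: interval_prod_meet => i; apply/Ple/Pab.
Qed.

Lemma has_box_repr_endpoints G k :
  has_box_repr R G k <-> endpoint_repr (fun x y => x <= y) G k.
Proof. exact: intersection_repr_endpoints. Qed.

Lemma has_cube_repr_endpoints G k :
  has_cube_repr R G k <-> endpoint_repr (fun x y => y - x = 1) G k.
Proof.
by apply: intersection_repr_endpoints => x y xy; rewrite -subr_ge0 xy ler01.
Qed.

Lemma endpoint_repr_pullback P G H k m (phi : 'I_m -> G -> H) :
    (forall x y, P x y -> x <= y) ->
    (forall s u v, adj u v -> phi s u = phi s v \/ adj (phi s u) (phi s v)) ->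
    (forall u v, u != v -> ~~ adj u v ->
       exists s, phi s u != phi s v /\ ~~ adj (phi s u) (phi s v)) ->
  endpoint_repr P H k -> endpoint_repr P G (m * k).
Proof.
move=> Ple phi_adj phi_sep [a [b [Pab abr]]].
(* Concatenation: coordinate [mxvec_index s i] copies coordinate [i] of the pullback along
   [phi s]. *)
pose w (c : H -> 'rV[R]_k) u := mxvec (\matrix_(s, i) c (phi s u) ord0 i).
have wE c u s i : w c u ord0 (mxvec_index s i) = c (phi s u) ord0 i.
  by rewrite mxvecE mxE.
exists (w a), (w b); split=> [v i|u v uv].
  by case/mxvec_indexP: i => s i; rewrite !wE.
split=> [auv i|meet].
  case/mxvec_indexP: i => s i; rewrite !wE.
  have [->|asuv] := phi_adj s u v auv; first by split; apply/Ple.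
  have neq : phi s u != phi s v.
    by apply/eqP => e; rewrite e adj_irrefl in asuv.
  exact: (proj1 (abr _ _ neq)).
apply: contraT => nauv; have [s [neq /negP[]]] := phi_sep u v uv nauv.
apply/(abr _ _ neq) => i; have := meet (mxvec_index s i).
by rewrite !wE.
Qed.

Lemma boxicity_le G k : has_box_repr R G k -> (boxicity R G <= k)%N.
Proof. by move=> /asboolP Gk; rewrite /boxicity; case: ex_minnP => n _; apply. Qed.

Lemma cubicity_le G k : has_cube_repr R G k -> (cubicity R G <= k)%N.
Proof. by move=> /asboolP Gk; rewrite /cubicity; case: ex_minnP => n _; apply. Qed.

Lemma has_box_repr_boxicity G : has_box_repr R G (boxicity R G).
Proof. by rewrite /boxicity; case: ex_minnP => n /asboolP. Qed.

Lemma has_cube_repr_cubicity G : has_cube_repr R G (cubicity R G).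
Proof. by rewrite /cubicity; case: ex_minnP => n /asboolP. Qed.

(** The largest left endpoint lies in every interval; [i0] guarantees that it exists. *)
Lemma helly_interval (I : finType) (i0 : I) (a b : I -> R) :
  (forall i j, a i <= b j) -> exists r, forall i, a i <= r <= b i.
Proof.
move=> ab; case: (@arg_maxP _ R I i0 xpredT a isT) => j _ max_j.
by exists (a j) => i; rewrite ab andbT; apply: max_j.
Qed.

End EndpointRepresentations.

(** * Adjacency in Hamming graphs *)

Lemma hamming_nadjP q d (x y : hamming q d) : x != y -> ~~ adj x y ->
  exists i j, [/\ i != j, x i != y i & x j != y j].
Proof.
move=> xy; rewrite /= /hamming_adj => nxy.
have /card_gt1P[i [j [xi xj ij]]] : (1 < #|[pred i | x i != y i]|)%N.
  rewrite ltn_neqAle eq_sym nxy lt0n /=.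
  apply: contra xy => /eqP/card0_eq xy0; apply/eqP/ffunP => i.
  by have := xy0 i; rewrite !inE => /negbFE/eqP.
by exists i, j.
Qed.

Lemma hamming_nadj q d (x y : hamming q d) (i j : 'I_d) :
  i != j -> x i != y i -> x j != y j -> ~~ adj x y.
Proof.
move=> ij xi xj; rewrite /= /hamming_adj neq_ltn; apply/orP; right.
by apply/card_gt1P; exists i, j.
Qed.

Lemma hamming_adjP q d (x y : hamming q d) : reflect
  (exists2 i, x i != y i & forall j, j != i -> x j = y j) (adj x y).
Proof.
apply: (iffP (@card1P _ _)) => [[i xyi]|[i xi xj]]; exists i.
- by have := xyi i; rewrite !inE eqxx.
- by move=> j /negbTE ji; have := xyi j; rewrite !inE ji => /negbFE/eqP.
- move=> j; rewrite !inE; have [->//|/xj->] := eqVneq j i.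
  by rewrite eqxx.
Qed.

(** * Lower bound from the rook's graph *)

Section LowerBound.
Variables (R : realType) (q d : nat).

(** A copy of the rook's graph: only the first two letters vary. *)
Definition rook (i j : 'I_q.+1) : hamming q.+1 d.+2 :=
  [ffun t : 'I_d.+2 => if t == 0 then i else if t == 1 then j else 0].

Lemma rook_row_adj i j j' : j != j' -> adj (rook i j) (rook i j').
Proof.
move=> jj'; apply/hamming_adjP; exists 1; rewrite ?ffunE //= => t /negbTE t1.
by rewrite !ffunE t1.
Qed.

Lemma rook_col_adj i i' j : i != i' -> adj (rook i j) (rook i' j).
Proof.
move=> ii'; apply/hamming_adjP; exists 0; rewrite ?ffunE //= => t /negbTE t0.
by rewrite !ffunE t0.
Qed.

Lemma rook_nadj i i' j j' :
  i != i' -> j != j' -> ~~ adj (rook i j) (rook i' j').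
Proof. by move=> ii' jj'; apply: (@hamming_nadj _ _ _ _ 0 1); rewrite ?ffunE. Qed.

Lemma rook_inj i i' j j' : rook i j = rook i' j' -> i = i' /\ j = j'.
Proof.
move=> /ffunP e; have := e 0; have := e 1.
by rewrite !ffunE /= => -> ->.
Qed.

Lemma leq_exp2_box_repr k :
  has_box_repr R (hamming q.+1 d.+2) k -> (q.+1 <= 2 ^ k)%N.
Proof.
move=> /has_box_repr_endpoints[a [b [ab abr]]].
have meet u v t : u = v \/ adj u v -> a u ord0 t <= b v ord0 t.
  have [->|uv] := eqVneq u v; first by rewrite ab.
  by case=> [/eqP|/(abr _ _ uv) e]; [rewrite (negbTE uv) | apply: (proj1 (e t))].
have /choice[r rP] : forall p : 'I_q.+1 * 'I_k, exists z : R, forall j,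
    a (rook p.1 j) ord0 p.2 <= z <= b (rook p.1 j) ord0 p.2.
  case=> i t /=; apply: (helly_interval ord0) => j j'; apply: meet.
  by have [->|/(rook_row_adj i)] := eqVneq j j'; [left | right].
have /choice[c cP] : forall p : 'I_q.+1 * 'I_k, exists z : R, forall i,
    a (rook i p.1) ord0 p.2 <= z <= b (rook i p.1) ord0 p.2.
  case=> j t /=; apply: (helly_interval ord0) => i i'; apply: meet.
  by have [->|/(rook_col_adj j)] := eqVneq i i'; [left | right].
pose side i := [ffun t : 'I_k => r (i, t) < c (i, t)].
suff /leq_card : injective side.
  by rewrite card_ffun !card_ord card_bool.
move=> i j /ffunP side_ij; apply: contraTeq isT => ij.
have ji : j != i by rewrite eq_sym.
have /negP[] := rook_nadj ij ji.
have neq : rook i j != rook j i.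
  by apply: contra ij => /eqP/rook_inj[->].
apply/(abr _ _ neq) => t.
have /andP[ari rib] := rP (i, t) j; have /andP[arj rjb] := rP (j, t) i.
have /andP[aci cib] := cP (i, t) j; have /andP[acj cjb] := cP (j, t) i.
have := side_ij t; rewrite !ffunE /= in ari rib arj rjb aci cib acj cjb *.
(* The interval of [rook i j] contains [r (i, t)] and [c (j, t)], that of [rook j i] contains
   [r (j, t)] and [c (i, t)]. If each [r] is below its [c], left endpoints are compared with right
   ones through [r < c]; otherwise through [c <= r]. *)
case: (ltP (r (i, t))) => rci; case: (ltP (r (j, t))) => // rcj _.
  split; first exact: le_trans (le_trans ari (ltW rci)) cib.
  exact: le_trans (le_trans arj (ltW rcj)) cjb.
split; first exact: le_trans (le_trans acj rcj) rjb.
exact: le_trans (le_trans aci rci) rib.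
Qed.

End LowerBound.

(** * Counting maps that split pairs of letters *)

Section SplittingFamilies.
Variable q : nat.
Implicit Types (h u w : {ffun 'I_q -> bool}) (a b c d : 'I_q).

Definition splits h a b c d := (h a != h b) && (h c != h d).

(** If [a = c], [a = d] or [b = c], the indicator of the shared letter works; otherwise that of {a,
    c}, even when [b = d]. *)
Lemma splits_exists a b c d : a != b -> c != d -> exists u, splits u a b c d.
Proof.
move=> ab cd; have ba : b != a by rewrite eq_sym.
have dc : d != c by rewrite eq_sym.
have [ac|ac] := eqVneq a c.
  exists [ffun x => x == a].
  by rewrite /splits !ffunE eqxx (negbTE ba) -ac eqxx ac (negbTE dc).
have [ad|ad] := eqVneq a d.
  exists [ffun x => x == a].
  by rewrite /splits !ffunE eqxx (negbTE ba) -ad eqxx ad (negbTE cd).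
have [bc|bc] := eqVneq b c.
  exists [ffun x => x == b].
  by rewrite /splits !ffunE eqxx (negbTE ab) -bc eqxx bc (negbTE dc).
exists [ffun x => (x == a) || (x == c)].
rewrite /splits !ffunE !eqxx (negbTE ba) (negbTE bc) (negbTE dc).
by rewrite (eq_sym d) (negbTE ad) orbT.
Qed.

(* The fibres of the F_2-linear map h |-> (h a + h b, h c + h d) are empty or
   translates of each other; the fibre over (1, 1) is not empty. *)
Lemma card_splits a b c d : a != b -> c != d ->
  (#|{: {ffun 'I_q -> bool}}| <= 4 * #|[pred h | splits h a b c d]|)%N.
Proof.
move=> ab cd; have [u /andP[uab ucd]] := splits_exists ab cd.
pose L h := (h a (+) h b, h c (+) h d).
have fibre v : (#|[pred h | L h == v]| <= #|[pred h | splits h a b c d]|)%N.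
  have [/pred0P e|/pred0Pn[w /= /eqP wv]] := boolP (pred0b [pred h | L h == v]).
    by rewrite (eq_card0 e).
  (* As [L w = v] and [L u = (1, 1)], adding [w + u] carries the fibre over [v] into the fibre over
     (1, 1). *)
  pose shift h : {ffun 'I_q -> bool} := [ffun x => h x (+) (w x (+) u x)].
  have shift_inj : injective shift.
    move=> h h' /ffunP e; apply/ffunP => x.
    by have := e x; rewrite !ffunE => /addIb.
  rewrite -(card_image shift_inj); apply/subset_leq_card/fintype.subsetP => y.
  move=> /fintype.imageP[h]; rewrite !inE -wv => /eqP[hab hcd] ->.
  rewrite /splits !ffunE.
  move: hab hcd uab ucd.
  by case: (h a) (h b) (w a) (w b) (u a) (u b) => [] [] [] [] [] [] //=;
     case: (h c) (h d) (w c) (w d) (u c) (u d) => [] [] [] [] [] [].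
rewrite -[4%N]/(2 * 2)%N -card_bool -card_prod -sum1_card.
rewrite (partition_big L xpredT) //= -sum_nat_const.
by apply: leq_sum => v _; rewrite sum1_card; apply: fibre.
Qed.

Lemma splitting_family m : (q ^ 4 * 3 ^ m < 4 ^ m)%N ->
  exists f : 'I_m -> {ffun 'I_q -> bool}, forall a b c d,
    a != b -> c != d -> exists s, splits (f s) a b c d.
Proof.
move=> qm; pose H := {ffun 'I_q -> bool}.
pose Q := (('I_q * 'I_q) * ('I_q * 'I_q))%type.
pose dist (p : Q) := (p.1.1 != p.1.2) && (p.2.1 != p.2.2).
pose bad (p : Q) := [pred h : H | ~~ splits h p.1.1 p.1.2 p.2.1 p.2.2].
have H_gt0 : (0 < #|{: H}|)%N by rewrite card_ffun card_bool expn_gt0.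
have card_bad p : dist p -> (4 * #|bad p| <= 3 * #|{: H}|)%N.
  move=> /andP[/card_splits/[apply]]; rewrite -/H.
  rewrite -(cardC [pred h : H | splits h p.1.1 p.1.2 p.2.1 p.2.2]).
  rewrite (@eq_card _ [predC _] (bad p)) //.
  set x := #|_|; set y := #|_|.
  by rewrite (mulSn 3 x) (mulSn 3 y) mulnDr leq_add2l leq_add2r.
have [/existsP[f /forallP fP]|none] := boolP [exists f : {ffun 'I_m -> H},
    [forall p : Q, dist p ==> (f \notin ffun_on (bad p))]].
  exists f => a b c d ab cd; have := fP ((a, b), (c, d)).
  rewrite /dist /= ab cd /= => /forallPn /= [s]; rewrite !inE negbK => fs.
  by exists s.
(* If no family works, each one consists entirely of maps that are bad for some common [p]. *)
have cover : (#|{: {ffun 'I_m -> H}}| <= \sum_(p | dist p) #|bad p| ^ m)%N.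
  rewrite -sum1_card.
  apply: (@leq_trans (\sum_(f : {ffun 'I_m -> H})
                       \sum_(p | dist p) (f \in ffun_on (bad p)))%N).
    apply: leq_sum => f _; have /existsPn/(_ f)/forallPn[p] := none.
    rewrite negb_imply negbK => /andP[dp fp].
    by rewrite (bigD1 p) //= fp.
  rewrite exchange_big leq_sum // => p _.
  by rewrite -big_mkcond sum1_card card_ffun_on card_ord.
suff : (#|{: {ffun 'I_m -> H}}| < #|{: {ffun 'I_m -> H}}|)%N by rewrite ltnn.
(* The factor [4 ^ m] clears the denominators of the probabilities (3/4)^m. *)
rewrite -(@ltn_pmul2l (4 ^ m)) ?expn_gt0 //.
apply: (@leq_ltn_trans (q ^ 4 * (3 * #|{: H}|) ^ m)%N); last first.
  have -> : #|{: {ffun 'I_m -> H}}| = (#|{: H}| ^ m)%N.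
    by rewrite card_ffun card_ord.
  by rewrite expnMn mulnA ltn_pmul2r ?expn_gt0 ?H_gt0.
apply: leq_trans (leq_mul (leqnn _) cover) _.
rewrite big_distrr /=.
apply: (@leq_trans (\sum_(p : Q) (3 * #|{: H}|) ^ m)%N); last first.
  by rewrite sum_nat_const !card_prod card_ord -!mulnA.
rewrite big_mkcond leq_sum // => p _; case: ifP => // dp.
by rewrite -expnMn; case: (m) => // m'; rewrite leq_exp2r ?card_bad.
Qed.

Lemma exp_union_bound m : (1 < q)%N -> (q ^ 10 <= 2 ^ m)%N ->
  (q ^ 4 * 3 ^ m < 4 ^ m)%N.
Proof.
move=> q_gt1 qm; have m_gt0 : (0 < m)%N.
  case: m qm => //; rewrite expn0 leqNgt -{1}(exp1n 10) ltn_exp2r //.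
  by rewrite q_gt1.
(* After taking fifth powers, [q ^ 20 <= 4 ^ m] leaves 4 * 3^5 = 972 < 1024 = 4^5, raised to the
   power [m]; strictness uses [m > 0]. *)
rewrite -(@ltn_exp2r _ _ 5) // expnMn -!expnM.
have q20 : (q ^ 20 <= 4 ^ m)%N.
  by rewrite -[4%N]/(2 ^ 2)%N -expnM mulnC expnM (expnM q 10 2) leq_exp2r.
apply: (@leq_ltn_trans (4 ^ m * 3 ^ (m * 5))%N).
  by rewrite leq_mul2r q20 orbT.
by rewrite [(m * 5)%N]mulnC !(expnM _ 5 m) -expnMn ltn_exp2r.
Qed.

Lemma splitting_family_log m : (q ^ 10 <= 2 ^ m)%N ->
  exists f : 'I_m -> {ffun 'I_q -> bool}, forall a b c d,
    a != b -> c != d -> exists s, splits (f s) a b c d.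
Proof.
move=> qm; have [q1|/exp_union_bound/(_ qm)/splitting_family //] := leqP q 1.
(* With at most one letter there are no distinct pairs. The counting bound would fail for [q = 1],
   [m = 0]. *)
exists (fun=> [ffun=> true]) => a b c d /eqP[]; apply: val_inj => /=.
by case: q q1 a b {c d} => [|[|]] // _ [[]] // ? [[]].
Qed.

End SplittingFamilies.

(** * Upper bound by recoding words into the hypercube *)

Section UpperBound.
Variables (R : realType) (q d : nat).

Definition recode (h : {ffun 'I_q -> bool}) (x : hamming q d) : hamming 2 d :=
  [ffun i => if h (x i) then 1 else 0].

Lemma recode_neq h (x y : hamming q d) i :
  (recode h x i != recode h y i) = (h (x i) != h (y i)).
Proof. by rewrite !ffunE; case: (h (x i)) (h (y i)) => [] []. Qed.

Lemma endpoint_repr_hamming (P : R -> R -> Prop) k m :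
    (forall x y, P x y -> x <= y) -> (q ^ 10 <= 2 ^ m)%N ->
  endpoint_repr P (hamming 2 d) k -> endpoint_repr P (hamming q d) (m * k).
Proof.
move=> Ple /splitting_family_log[f f_splits].
apply: (endpoint_repr_pullback (phi := fun s => recode (f s))) => //.
  move=> s x y /hamming_adjP[i _ xy].
  have [hi|hi] := eqVneq (f s (x i)) (f s (y i)); [left|right].
    apply/ffunP => j; rewrite !ffunE.
    by have [->|/xy->//] := eqVneq j i; rewrite hi.
  apply/hamming_adjP; exists i; first by rewrite recode_neq.
  by move=> j /xy xyj; rewrite !ffunE xyj.
move=> x y xy /(hamming_nadjP xy)[i [j [ij xi xj]]].
(* Both places must be split by the same map: splitting just one could leave the images adjacent. *)
have [s /andP[si sj]] := f_splits _ _ _ _ xi xj; exists s.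
split; last by apply: (hamming_nadj ij); rewrite recode_neq.
by apply: contraNneq si => e; rewrite -(negbK (_ == _)) -recode_neq e eqxx.
Qed.

End UpperBound.

(** * Logarithmic bounds as inequalities between integers *)

Lemma log2_le (R : realType) (q k : nat) :
  (0 < q)%N -> (q <= 2 ^ k)%N -> log2 (q%:R : R) <= k%:R.
Proof.
move=> q_gt0 qk; rewrite /log2 ler_pdivrMr ?ln_gt0 ?ltr1n // mulr_natl.
by rewrite -lnXn ?ltr0n // ler_ln ?posrE ?exprn_gt0 ?ltr0n // -natrX ler_nat.
Qed.

Lemma ceil_log2 (R : realType) (q : nat) : (0 < q)%N ->
  exists2 m : nat, Num.ceil (10 * log2 (q%:R : R)) = m%:Z & (q ^ 10 <= 2 ^ m)%N.
Proof.
move=> q_gt0; have ln2 : 0 < ln 2 :> R by rewrite ln_gt0 ?ltr1n.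
have log_ge0 : 0 <= 10 * log2 (q%:R : R).
  by rewrite mulr_ge0 // divr_ge0 ?(ltW ln2) // ln_ge0 // ler1n.
have : 0 <= Num.ceil (10 * log2 (q%:R : R)).
  by rewrite ceil_ge0 (lt_le_trans _ log_ge0) // ltrN10.
have := ceil_ge (10 * log2 (q%:R : R)).
case: (Num.ceil _) => // m le_m _; exists m => //.
move: le_m; rewrite /log2 mulrA ler_pdivrMr // !mulr_natl.
rewrite -!lnXn ?ltr0n // ler_ln ?posrE ?exprn_gt0 ?ltr0n //.
by rewrite -!natrX ler_nat.
Qed.

Theorem theorem6 (R : realType) (q d : nat) (hq : (1 <= q)%N) (hd : (2 <= d)%N) :
  [/\ log2 (q%:R : R) <= (boxicity R (hamming q d))%:R,
      (boxicity R (hamming q d))%:R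
        <= (Num.ceil (10 * log2 (q%:R : R)))%:~R * (boxicity R (hamming 2 d))%:R :> R,
      log2 (q%:R : R) <= (cubicity R (hamming q d))%:R &
      (cubicity R (hamming q d))%:R
        <= (Num.ceil (10 * log2 (q%:R : R)))%:~R * (cubicity R (hamming 2 d))%:R :> R].
Proof.
(* Stated for boxes, this also serves cubicity, because a cube representation is a box
   representation. *)
have lower k : has_box_repr R (hamming q d) k -> log2 (q%:R : R) <= k%:R.
  move=> qdk; apply: log2_le => //; move: qdk.
  by case: q hq d hd => // q' _ [|[|d']] // _; apply: leq_exp2_box_repr.
have [m -> qm] := ceil_log2 R hq; split.
- exact/lower/has_box_repr_boxicity.
- rewrite -natrM ler_nat; apply: boxicity_le; apply/has_box_repr_endpoints.
  apply: endpoint_repr_hamming => //.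
  exact/has_box_repr_endpoints/has_box_repr_boxicity.
- exact/lower/cube_box_repr/has_cube_repr_cubicity.
- rewrite -natrM ler_nat; apply: cubicity_le; apply/has_cube_repr_endpoints.
  apply: endpoint_repr_hamming => //.
    by move=> x y xy; rewrite -subr_ge0 xy ler01.
  exact/has_cube_repr_endpoints/has_cube_repr_cubicity.
Qed.
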